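(* Let $S=\operatorname{conv}\{v_0,\dots,v_d\}\subseteq\mathbb{R}^d$ be a $d$-simplex with the origin in its interior and with rational vertex directions. For each $i$ and $t\in[0,1]$ let $S^{(i)}_t=\operatorname{conv}\{v_0,\dots,tv_i,\dots,v_d\}$ (the $i$-th vertex replaced by $tv_i$), and let $\pi_i:\mathbb{R}^d\to\mathbb{R}^{d-1}$ be the linear projection with kernel $\mathbb{R}v_i$. Then there is an index $j\in\{0,\dots,d\}$ such that \[\lim_{t\to0}\frac12\,\frac{\sum_{i=0}^d\operatorname{Vol}_{\pi_i(\mathbb{Z}^d)}(\pi_i(S^{(j)}_t))}{\operatorname{Vol}_{\mathbb{Z}^d}(S^{(j)}_t)}\ \ge\ \frac{\sum_{i=0,i\ne j}^d\operatorname{Vol}_{\pi_i(\mathbb{Z}^d)}(\pi_i(S^{(j)}_0))}{\operatorname{Vol}_{\mathbb{Z}^d}(S^{(j)}_0)},\] with equality if and only if the primitive lattice vectors parallel (and with the same orientation) to $v_0,\dots,v_d$ add up to zero.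
   Context: Rational vertex directions: each line $\mathbb{R}v_i$ has rational direction. $\operatorname{Vol}_\Lambda(K)=k!\operatorname{vol}(K)/\det\Lambda$ is the normalized volume of a $k$-dimensional body w.r.t. a full-rank lattice $\Lambda$. *)

(* Defs.v *)
From HB Require Import structures.
From mathcomp Require Export all_boot all_order all_algebra.
From mathcomp Require Export all_classical all_reals all_analysis.
Export Order.TTheory GRing.Theory Num.Theory.
Export numFieldNormedType.Exports.
Set Implicit Arguments.
Unset Strict Implicit.
Unset Printing Implicit Defensive.
Local Open Scope classical_set_scope.
Local Open Scope ring_scope.

Definition conv_hull (R : realType) (d m : nat) (v : 'I_m -> 'rV[R]_d) :
    set 'rV[R]_d :=
  [set x | exists a : 'I_m -> R,
     [/\ forall k, 0 <= a k, \sum_k a k = 1 & x = \sum_k a k *: v k]].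

Definition affinely_independent (R : realType) (d m : nat)
    (v : 'I_m -> 'rV[R]_d) : Prop :=
  forall a : 'I_m -> R,
    \sum_k a k = 0 -> \sum_k a k *: v k = 0 -> forall k, a k = 0.

Definition slice (R : realType) (n : nat) (A : set 'rV[R]_n.+1) (x : R) :
    set 'rV[R]_n :=
  [set y | A (row_mx (x%:M : 'M[R]_1) y : 'rV[R]_n.+1)].

(* The n-fold product of the Lebesgue measure of R: row vectors are read as
   elements of R * (R * ...), and each step is the library's product measure
   [fun A => \int[m1]_x m2 (xsection A x)] unfolded.  R^0 is a point of mass 1.
   As usual it is the volume on Borel sets, hence on compact convex bodies. *)
Fixpoint lebesgue_vol (R : realType) (n : nat) : set 'rV[R]_n -> \bar R :=
  match n with
  | 0 => fun A : set 'rV[R]_0 => (\1_A (0 : 'rV[R]_0))%:E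
  | m.+1 => fun A : set 'rV[R]_m.+1 =>
      (\int[@lebesgue_measure R]_x lebesgue_vol (slice A x))%E
  end.

Definition lattice_span (R : realType) (n : nat) (B : 'M[R]_n) : set 'rV[R]_n :=
  [set x | exists z : 'rV[int]_n, x = map_mx intr z *m B].

Definition lattice_basis (R : realType) (n : nat) (L : set 'rV[R]_n)
    (B : 'M[R]_n) : Prop :=
  B \in unitmx /\ L = lattice_span B.

(* Independent of the basis chosen; meaningless if [L] is not a full-rank
   lattice. *)
Definition lattice_det (R : realType) (n : nat) (L : set 'rV[R]_n) : R :=
  `| \det (xget 0 [set B | lattice_basis L B]) |.

Definition int_lattice (R : realType) (n : nat) : set 'rV[R]_n :=
  [set x | exists z : 'rV[int]_n, x = map_mx intr z].
Arguments int_lattice : clear implicits.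

Definition normalized_vol (R : realType) (n : nat) (L K : set 'rV[R]_n) : R :=
  n`!%:R * fine (lebesgue_vol K) / lattice_det L.

(* In particular [v != 0], so that the multiples of [v] do form a line. *)
Definition rational_direction (R : realType) (d : nat) (v : 'rV[R]_d) : Prop :=
  exists q : 'rV[rat]_d, q != 0 /\ exists c : R, map_mx ratr q = c *: v.

Definition primitive_vector (d : nat) (u : 'rV[int]_d) : Prop :=
  \big[gcdn/0%N]_(k < d) absz (u 0 k) = 1%N.

(* The primitive vector of Z^d on the ray of [v]: it exists and is unique as
   soon as [v] has a rational direction. *)
Definition primitive_dir (R : realType) (d : nat) (v : 'rV[R]_d) :
    'rV[int]_d :=
  xget 0 [set u | primitive_vector u /\
                  exists2 c : R, 0 < c & map_mx intr u = c *: v].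

Definition shrink_vertex (R : realType) (d m : nat) (v : 'I_m -> 'rV[R]_d)
    (j : 'I_m) (t : R) : set 'rV[R]_d :=
  conv_hull (fun k => if k == j then t *: v k else v k).

(* Main.v *)
Require Import Defs.
From mathcomp Require Import measurable_realfun ring lra.
Set Implicit Arguments.
Unset Strict Implicit.
Unset Printing Implicit Defensive.
Local Open Scope classical_set_scope.
Local Open Scope ring_scope.

(** Let [b k] be the barycentric coordinates of the origin and [c k *: v k] the
    primitive vector on the ray of [v k]. Projecting a simplex that contains the
    origin along its [i]-th vertex multiplies the normalized volume by
    [c i * (1 - b i)]. For the shrunk simplices the left-hand side therefore
    tends to [(\sum_(i != j) c i + c j * (1 - b j) / b j) / 2], while the
    right-hand side is [\sum_(i != j) c i]. It suffices to take for [j] a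
    minimiser of [b j / c j]; equality means that [c] is proportional to [b].

    The volume of a simplex comes from the linear change of variables for
    polyhedra, a class closed under slices and affine preimages: it is proved
    for block triangular matrices and for the exchange of the first two
    coordinates (Fubini), and these generate the linear group. *)

Lemma lebesgue_vol_ge0 (R : realType) n (A : set 'rV[R]_n) :
  (0 <= lebesgue_vol A)%E.
Proof.
elim: n A => [|n IH] A /=; first by rewrite lee_fin indicE.
by apply: integral_ge0 => x _; exact: IH.
Qed.

Lemma lebesgue_measure_affine (R : realType) (a w : R) (A : set R) :
  a != 0 -> measurable (A : set (measurableTypeR R)) ->
  (`|a|%:E * lebesgue_measure ((fun x => (a * x + w)%R) @^-1` A) =
   lebesgue_measure A)%E.
Proof.
move=> a0 mA.
have mphi : measurable_fun (setT : set (measurableTypeR R))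
    ((fun x => a * x + w) : measurableTypeR R -> measurableTypeR R).
  by apply: measurable_funD => //; exact: measurable_funM.
pose push : {measure set (measurableTypeR R) -> \bar R} :=
  measure_function_pushforward__canonical__measure_function_Measure
    lebesgue_measure mphi.
pose nu : {measure set (measurableTypeR R) -> \bar R} :=
  mscale (NngNum (normr_ge0 a)) push.
suff : lebesgue_measure A = nu A by move=> ->.
apply: lebesgue_measure_unique => //= _ [[p q]] _ <-.
change (lebesgue_measure `]p, q]%classic =
  (`|a|%:E * lebesgue_measure ((fun x => (a * x + w)%R) @^-1` `]p, q]%classic))%E).
move: a0; rewrite neq_lt => /orP[a0|a0].
- rewrite (_ : _ @^-1` _ = `[(q - w) / a, (p - w) / a[%classic); last first.
    apply/seteqP; split => x /=; rewrite !in_itv/= ler_ndivrMr// ltr_ndivlMr//;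
    by move=> /andP[h1 h2]; apply/andP; split; lra.
  rewrite !lebesgue_measure_itv/= !lte_fin ltr_ndivlMr// divfK ?lt_eqF//.
  rewrite ltrBlDr subrK; case: ifPn => _; last by rewrite mule0.
  rewrite ltr0_norm// -!EFinB -EFinM; congr EFin; field; lra.
- rewrite (_ : _ @^-1` _ = `](p - w) / a, (q - w) / a]%classic); last first.
    apply/seteqP; split => x /=; rewrite !in_itv/= ler_pdivlMr// ltr_pdivrMr//;
    by move=> /andP[h1 h2]; apply/andP; split; lra.
  rewrite !lebesgue_measure_itv/= !lte_fin ltr_pdivrMr// divfK ?gt_eqF//.
  rewrite ltrBlDr subrK; case: ifPn => _; last by rewrite mule0.
  rewrite gtr0_norm// -!EFinB -EFinM; congr EFin; field; lra.
Qed.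

Lemma ge0_integral_affine (R : realType) (a w : R)
    (f : measurableTypeR R -> \bar R) :
  a != 0 -> measurable_fun setT f -> (forall x, 0 <= f x)%E ->
  (\int[@lebesgue_measure R]_x f (a * x + w)%R =
   `|a|^-1%:E * \int[@lebesgue_measure R]_x f x)%E.
Proof.
move=> a0 mf f0.
have mphi : measurable_fun (setT : set (measurableTypeR R))
    ((fun x => a * x + w) : measurableTypeR R -> measurableTypeR R).
  by apply: measurable_funD => //; exact: measurable_funM.
have := @ge0_integral_pushforward _ _ _ _ R _ mphi lebesgue_measure setT f
  measurableT mf (fun x _ => f0 x).
rewrite preimage_setT => <-.
pose push : {measure set (measurableTypeR R) -> \bar R} :=
  measure_function_pushforward__canonical__measure_function_Measure
    lebesgue_measure mphi.
pose nu : {measure set (measurableTypeR R) -> \bar R} :=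
  mscale (NngNum (normr_ge0 a)) push.
have -> : (\int[lebesgue_measure]_x f x = \int[nu]_x f x)%E.
  apply: eq_measure_integral => A mA _.
  exact: (esym (lebesgue_measure_affine w a0 mA)).
rewrite ge0_integral_mscale//= muleA -EFinM mulVf ?normr_eq0// mul1e.
by [].
Qed.

Definition polyhedron (R : realType) n m (b : 'rV[R]_m) (C : 'M[R]_(n, m)) :
    set 'rV[R]_n := [set y | forall k, 0 <= (b + y *m C) 0 k].

Lemma slice_polyhedron (R : realType) n m (b : 'rV[R]_m)
    (C : 'M[R]_(1 + n, m)) x :
  slice (polyhedron b C) x = polyhedron (b + x *: usubmx C) (dsubmx C).
Proof.
rewrite /slice /polyhedron; apply/funext => y /=.
by rewrite -{1}(vsubmxK C) mul_row_col mul_scalar_mx addrA.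
Qed.

Lemma measurable_vol_polyhedron (R : realType) n m dX (X : measurableType dX)
    (b : X -> 'rV[R]_m) (C : 'M[R]_(n, m)) :
  (forall k, measurable_fun setT (fun x => b x 0 k)) ->
  measurable_fun setT (fun x => lebesgue_vol (polyhedron (b x) C)).
Proof.
elim: n dX X b C => [|n IH] dX X b C mb.
  rewrite /=.
  have -> : (fun x => (\1_(polyhedron (b x) C) (0 : 'rV[R]_0))%:E) =
      EFin \o (\1_[set x | forall k, 0 <= b x 0 k] : X -> R).
    apply/funext => x /=; rewrite !indicE.
    congr (_%:R%:E); congr nat_of_bool; apply/idP/idP;
    by rewrite !inE /polyhedron /= mul0mx addr0.
  apply/measurable_EFinP; apply: measurable_indic.
  have -> : [set x | forall k, 0 <= b x 0 k] =
      \big[setI/setT]_(k < m) [set x | 0 <= b x 0 k].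
    apply/seteqP; split => x /=.
      by move=> h; elim/big_ind: _ => //= A B; split.
    by move=> h k; move: h; rewrite (bigD1 k)//= => -[].
  apply: bigsetI_measurable => k _.
  rewrite (_ : [set _ | _] = (fun x => b x 0 k) @^-1` `[0, +oo[%classic); last first.
    by apply/seteqP; split => x /=; rewrite in_itv/= andbT.
  by rewrite -[_ @^-1` _]setTI; exact: mb.
pose f (p : X * measurableTypeR R) :=
  lebesgue_vol (polyhedron (b p.1 + p.2 *: usubmx (C : 'M[R]_(1 + n, m)))
    (dsubmx (C : 'M[R]_(1 + n, m)))).
rewrite (_ : (fun _ => _) =
   (fun x => (\int[@lebesgue_measure R]_y f (x, y))%E)); last first.
  apply/funext => x /=; apply: eq_integral => y _.
  by rewrite slice_polyhedron.
apply: measurable_fun_fubini_tonelli_F => [|p]; last exact: lebesgue_vol_ge0.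
apply: IH => k.
rewrite (_ : (fun _ => _) =
  (fun p => b p.1 0 k + p.2 * (usubmx (C : 'M[R]_(1 + n, m))) 0 k)); last first.
  by apply/funext => p; rewrite !mxE.
apply: measurable_funD; first exact: (measurableT_comp (mb k)).
exact: measurable_funM.
Qed.

Lemma lebesgue_vol0 (R : realType) n : lebesgue_vol (set0 : set 'rV[R]_n) = 0%E.
Proof.
elim: n => [|n IH] /=; first by rewrite indic0.
rewrite (_ : (fun _ => _) = cst 0%E) ?integral0//.
by apply/funext => x; rewrite -IH; congr lebesgue_vol.
Qed.

Lemma is_derive_exp_subr (R : realType) (r c : R) n (x : R) :
  is_derive x 1 (fun y : R => - (c * (r - y) ^+ n.+1))
    (c * n.+1%:R * (r - x) ^+ n).
Proof.
pose p : {poly R} := - (c *: (r%:P - 'X) ^+ n.+1).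
rewrite (_ : (fun _ => _) = horner p); last first.
  by apply/funext => y; rewrite !hornerE.
apply: is_derive_eq (is_derive_poly p x) _.
rewrite derivN derivZ deriv_exp derivB derivC derivX sub0r /=.
rewrite mulN1r mulNrn scalerN opprK hornerZ hornerMn horner_exp !hornerE.
by rewrite -mulrA mulr_natl.
Qed.

Lemma integral_exp_subr (R : realType) (r : R) n : 0 <= r ->
  (\int[@lebesgue_measure R]_(x in `[0%R, r]) ((r - x) ^+ n / n`!%:R)%:E =
   (r ^+ n.+1 / n.+1`!%:R)%:E)%E.
Proof.
rewrite le_eqVlt => /predU1P[<-|r0].
  by rewrite set_itv1 integral_set1 expr0n/= mul0r.
pose F (y : R) := - (n.+1`!%:R^-1 * (r - y) ^+ n.+1).
have cF : continuous F.
  move=> x; apply: differentiable_continuous; apply/derivable1_diffP.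
  by have [] := is_derive_exp_subr r (n.+1`!%:R^-1) n x.
rewrite (@continuous_FTC2 _ _ F)//.
- by rewrite /F subrr expr0n/= mulr0 oppr0 addr0 -EFinB sub0r opprK mulrC.
- apply: continuous_subspaceT.
  rewrite (_ : (fun _ => _) = horner (n`!%:R^-1 *: (r%:P - 'X) ^+ n)).
    exact: continuous_horner.
  by apply/funext => y; rewrite hornerZ horner_exp !hornerE mulrC.
- split => //.
  + by move=> x _; have [] := is_derive_exp_subr r (n.+1`!%:R^-1) n x.
  + exact/cvg_at_right_filter/cF.
  + exact/cvg_at_left_filter/cF.
- move=> x _; rewrite derive1E.
  have [_ ->] := is_derive_exp_subr r (n.+1`!%:R^-1) n x.
  rewrite mulrC; congr (_ * _).
  by rewrite factS natrM invfM mulrAC mulVf ?mul1r// pnatr_eq0.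
Qed.

Definition std_simplex (R : realType) n (r : R) : set 'rV[R]_n :=
  [set y | (forall k, 0 <= y 0 k) /\ \sum_k y 0 k <= r].

Lemma vol_std_simplex (R : realType) n (r : R) :
  lebesgue_vol (@std_simplex R n r) =
  (if 0 <= r then r ^+ n / n`!%:R else 0)%:E.
Proof.
elim: n r => [|n IH] r.
  rewrite /= expr0 fact0 divr1 indicE /std_simplex; congr (_%:E).
  rewrite (_ : _ \in _ = (0 <= r)) => [|]; first by case: ifP.
  apply/idP/idP; rewrite inE/= big_ord0; first by case.
  by move=> r0; split => // -[].
have sl x : slice (@std_simplex R n.+1 r) x =
    if 0 <= x then std_simplex (r - x) else set0.
  have e0 (y : 'rV[R]_n) :
      (row_mx (x%:M : 'M[R]_1) y : 'rV[R]_n.+1) 0 ord0 = x.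
    transitivity ((row_mx (x%:M : 'M[R]_1) y) 0 (lshift n (ord0 : 'I_1))).
      by congr (fun_of_matrix _ _ _); exact/val_inj.
    by rewrite row_mxEl mxE.
  have eS (y : 'rV[R]_n) k :
      (row_mx (x%:M : 'M[R]_1) y : 'rV[R]_n.+1) 0 (lift ord0 k) = y 0 k.
    transitivity ((row_mx (x%:M : 'M[R]_1) y) 0 (rshift 1 k)).
      by congr (fun_of_matrix _ _ _); exact/val_inj.
    by rewrite row_mxEr.
  apply/seteqP; split => y; rewrite /slice /std_simplex /=.
    rewrite big_ord_recl e0 => -[h1 h2]; rewrite -(e0 y) h1; split.
      by move=> k; rewrite -(eS y) h1.
    by rewrite e0 lerBrDl -(eq_bigr _ (fun k _ => eS y k)).
  case: ifPn => // x0 [h1 h2]; split.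
    by move=> k; case: (unliftP ord0 k) => [k'|] ->; rewrite ?eS ?e0.
  by rewrite big_ord_recl e0 (eq_bigr _ (fun k _ => eS y k)) -lerBrDl.
rewrite /=.
under eq_integral => x _
  do rewrite sl (fun_if (@lebesgue_vol R n)) IH lebesgue_vol0 subr_ge0.
case: ifPn => r0; last first.
  rewrite integral0_eq// => x _; case: ifPn => // x0; case: ifPn => // xr.
  by move: r0; rewrite (le_trans x0 xr).
rewrite -integral_exp_subr// [RHS]integral_mkcond; apply: eq_integral => x _.
by rewrite patchE mem_setE in_itv/=; case: ifP => //= _; case: ifP.
Qed.

(* The preimage under [y |-> y *m M + w] of [polyhedron b C] is
   [polyhedron (b + w *m C) (M *m C)]. *)
Definition vol_scaled (R : realType) n (M : 'M[R]_n) : Prop :=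
  forall m (b : 'rV[R]_m) (C : 'M[R]_(n, m)) (w : 'rV[R]_n),
    lebesgue_vol (polyhedron (b + w *m C) (M *m C)) =
    (`|\det M|^-1%:E * lebesgue_vol (polyhedron b C))%E.

Lemma vol_scaledM (R : realType) n (M N : 'M[R]_n) :
  vol_scaled M -> vol_scaled N -> vol_scaled (M *m N).
Proof.
move=> hM hN m b C w; rewrite -mulmxA -[X in polyhedron X]addr0.
rewrite -[X in polyhedron (_ + X)](mul0mx _ (N *m C)) hM hN.
by rewrite muleA -EFinM det_mulmx normrM invfM.
Qed.

Lemma vol_scaled_block (R : realType) n (a : R) (r : 'rV[R]_n) (D : 'M[R]_n) :
  a != 0 -> vol_scaled D -> vol_scaled (block_mx a%:M r 0 D : 'M[R]_(1 + n)).
Proof.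
move=> a0 hD m b C w.
pose f x := lebesgue_vol (polyhedron (b + x *: usubmx C) (dsubmx C)).
have mf : measurable_fun (setT : set (measurableTypeR R)) f.
  apply: measurable_vol_polyhedron => k.
  rewrite (_ : (fun _ => _) = (fun x => b 0 k + x * (usubmx C) 0 k)).
    by apply: measurable_funD => //; exact: measurable_funM.
  by apply/funext => x; rewrite !mxE.
have E x : lebesgue_vol (slice (polyhedron (b + w *m C)
    (block_mx a%:M r 0 D *m C)) x) =
    (`|\det D|^-1%:E * f (a * x + lsubmx w 0 0)%R)%E.
  have -> : block_mx a%:M r 0 D *m C =
      col_mx (a *: usubmx C + r *m dsubmx C) (D *m dsubmx C).
    by rewrite -[in LHS](vsubmxK C) mul_block_col mul_scalar_mx mul0mx add0r.
  rewrite slice_polyhedron col_mxKu col_mxKd /f.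
  rewrite -(hD _ _ _ (rsubmx w + x *: r)); congr (lebesgue_vol (polyhedron _ _)).
  rewrite -[in LHS](hsubmxK w) -[in LHS](vsubmxK C) mul_row_col.
  rewrite [lsubmx w]mx11_scalar !mul_scalar_mx mulmxDl -scalemxAl.
  rewrite scalerDl scalerDr scalerA [x * a]mulrC -!addrA; congr (_ + _).
  rewrite !(col_mxKu, col_mxKd) [_%:M 0 0]mxE eqxx mulr1n (addrCA (rsubmx w *m _)).
  exact: addrCA.
rewrite det_ublock det_scalar1 normrM invfM /=.
under eq_integral => x _ do rewrite E.
rewrite ge0_integralZl//; last 2 first.
- apply: (measurableT_comp mf).
  by apply: measurable_funD => //; exact: measurable_funM.
- by move=> x _; exact: lebesgue_vol_ge0.
rewrite ge0_integral_affine// => [|x]; last exact: lebesgue_vol_ge0.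
rewrite muleA -EFinM [in LHS]mulrC; congr (_ * _)%E.
by apply: eq_integral => x _; rewrite slice_polyhedron.
Qed.

Lemma vol_scaled1 (R : realType) n : vol_scaled (1%:M : 'M[R]_n).
Proof.
elim: n => [|n IH].
  move=> m b C w; rewrite !mul1mx det_mx00 normr1 invr1 mul1e.
  by rewrite (flatmx0 C) mulmx0 addr0.
rewrite -[X in vol_scaled X]/(1%:M : 'M[R]_(1 + n)) scalar_mx_block.
by apply: vol_scaled_block IH; exact: oner_neq0.
Qed.

Lemma vol_polyhedron_translate (R : realType) n m (b : 'rV[R]_m)
    (C : 'M[R]_(n, m)) w :
  lebesgue_vol (polyhedron (b + w *m C) C) = lebesgue_vol (polyhedron b C).
Proof.
by have := vol_scaled1 b C w; rewrite mul1mx det1 normr1 invr1 mul1e.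
Qed.

Lemma vol_scaledV (R : realType) n (M : 'M[R]_n) :
  M \in unitmx -> vol_scaled M -> vol_scaled (invmx M).
Proof.
move=> uM hM m b C w.
have := hM _ (b + w *m C) (invmx M *m C) 0.
rewrite mul0mx addr0 mulKVmx// vol_polyhedron_translate.
move=> ->; rewrite muleA -EFinM det_inv normfV invrK divff ?mul1e//.
by rewrite normr_eq0 -unitfE -unitmxE.
Qed.

Definition swap_mx (R : realType) n : 'M[R]_(1 + (1 + n)) :=
  block_mx 0 (row_mx 1%:M 0) (col_mx 1%:M 0) (block_mx 0 0 0 1%:M).

Lemma mul_swap_mx (R : realType) n m (C : 'M[R]_(1 + (1 + n), m)) :
  swap_mx R n *m C =
  col_mx (usubmx (dsubmx C)) (col_mx (usubmx C) (dsubmx (dsubmx C))).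
Proof.
rewrite -[C in LHS](vsubmxK C) -[dsubmx C in LHS](vsubmxK (dsubmx C)).
rewrite /swap_mx mul_block_col mul_row_col mul_block_col mul_col_mx.
by rewrite !mul1mx !mul0mx add_col_mx !addr0 !add0r.
Qed.

Lemma swap_mxK (R : realType) n m (C : 'M[R]_(1 + (1 + n), m)) :
  swap_mx R n *m (swap_mx R n *m C) = C.
Proof.
by rewrite !mul_swap_mx !(col_mxKu, col_mxKd) !vsubmxK.
Qed.

Lemma swap_mx_unit (R : realType) n : swap_mx R n \in unitmx.
Proof.
have := swap_mxK (1%:M : 'M[R]_(1 + (1 + n))); rewrite mulmx1 => h.
by case: (mulmx1_unit h).
Qed.

Lemma norm_det_swap_mx (R : realType) n : `|\det (swap_mx R n)| = 1.
Proof.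
have := swap_mxK (1%:M : 'M[R]_(1 + (1 + n))); rewrite mulmx1 => /(congr1 determinant).
rewrite det_mulmx det1 => /(congr1 Num.norm); rewrite normrM normr1 -expr2 => /eqP.
by rewrite sqrp_eq1// => /eqP.
Qed.

Lemma vol_scaled_swap (R : realType) n : vol_scaled (swap_mx R n).
Proof.
move=> m b C w; rewrite norm_det_swap_mx invr1 mul1e.
rewrite -(vol_polyhedron_translate b C w).
move: (b + w *m C) => {}b; rewrite mul_swap_mx.
pose f (p : measurableTypeR R * measurableTypeR R) :=
  lebesgue_vol (polyhedron (b + p.1 *: usubmx C + p.2 *: usubmx (dsubmx C))
                  (dsubmx (dsubmx C))).
have mf : measurable_fun setT f.
  apply: measurable_vol_polyhedron => k.
  rewrite (_ : (fun _ => _) = (fun p => b 0 k + p.1 * (usubmx C) 0 k +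
     p.2 * (usubmx (dsubmx C)) 0 k)); last by apply/funext => p; rewrite !mxE.
  apply: measurable_funD; last exact: measurable_funM.
  by apply: measurable_funD => //; exact: measurable_funM.
transitivity (\int[@lebesgue_measure R]_y \int[@lebesgue_measure R]_x f (x, y))%E.
  apply: eq_integral => x _; rewrite slice_polyhedron.
  apply: eq_integral => y _; rewrite slice_polyhedron.
  by rewrite !(col_mxKu, col_mxKd) /f /= addrAC.
rewrite -(fubini_tonelli f mf) => [|p]; last exact: lebesgue_vol_ge0.
apply: eq_integral => x _; rewrite slice_polyhedron.
by apply: eq_integral => y _; rewrite slice_polyhedron.
Qed.

Lemma unitmx_to_delta (F : fieldType) n (c : 'cV[F]_(1 + n)) : c != 0 ->
  exists2 P : 'M[F]_(1 + n), P \in unitmx & P *m c = col_mx 1%:M 0.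
Proof.
move=> c0; have rc : \rank c = 1%N.
  by apply/eqP; rewrite eqn_leq rank_leq_col lt0n mxrank_eq0.
have := mulmx_ebase c; rewrite rc pid_mx_col => E.
have := row_ebase_unit c; rewrite [row_ebase c]mx11_scalar in E *.
move: (row_ebase c 0 0) (col_ebase c) (col_ebase_unit c) E => s L uL E.
rewrite unitmxE det_scalar1 unitfE => s0; exists (s^-1 *: invmx L).
  by rewrite unitmxZ ?unitmx_inv// unitfE invr_eq0.
rewrite -E -scalemxAl -mulmxA mulKmx//.
by rewrite mul_mx_scalar scalerA mulVf// scale1r.
Qed.

Lemma vol_scaled_unit (R : realType) n (M : 'M[R]_n) :
  M \in unitmx -> vol_scaled M.
Proof.
elim: n M => [|n IH] M uM.
  by rewrite [M](_ : _ = 1%:M); [exact: vol_scaled1|rewrite [M]flatmx0 flatmx0].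
have base (N : 'M[R]_(1 + n)) : N \in unitmx -> dlsubmx N = 0 -> vol_scaled N.
  move=> uN N0.
  have : N = block_mx (ulsubmx N 0 0)%:M (ursubmx N) 0 (drsubmx N).
    by rewrite -mx11_scalar -N0 submxK.
  move: (ulsubmx N 0 0) (ursubmx N) (drsubmx N) => a r D E; move: uN.
  rewrite E unitmxE det_ublock det_scalar1 unitrM unitfE -unitmxE => /andP[a0 uD].
  by apply: vol_scaled_block a0 (IH _ uD).
have [M0|M0] := eqVneq (dlsubmx (M : 'M[R]_(1 + n))) 0; first exact: base.
case: n => [|n] in M uM IH base M0 *; first by rewrite flatmx0 eqxx in M0.
change ('M[R]_(1 + (1 + n))) in M.
have [P uP Pc] := unitmx_to_delta M0.
pose r : 'rV[R]_(1 + n) := - (ulsubmx M *m (row_mx 1%:M 0 *m P)).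
pose T : 'M[R]_(1 + (1 + n)) := block_mx 1%:M r 0 P.
have uT : T \in unitmx.
  by rewrite unitmxE det_ublock det1 mul1r -unitmxE.
have hT : vol_scaled T by apply: vol_scaled_block (IH _ uP); exact: oner_neq0.
have uS := swap_mx_unit R n.
have -> : M = invmx T *m (invmx (swap_mx R n) *m (swap_mx R n *m (T *m M))).
  by rewrite (mulKmx uS) (mulKmx uT).
apply: vol_scaledM; first exact: vol_scaledV.
apply: vol_scaledM; first by apply: vol_scaledV => //; exact: vol_scaled_swap.
apply: base; first by rewrite !unitmx_mul uS uT uM.
have -> : T *m M = block_mx 0 (1%:M *m ursubmx M +
    r *m drsubmx M) (col_mx 1%:M 0)
    (P *m drsubmx M).
  rewrite /T -[in LHS](submxK M) mulmx_block.
  rewrite !mul0mx !add0r mul1mx Pc mulNmx -!mulmxA Pc mul_row_col mul1mx mul0mx.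
  by rewrite addr0 !mulmx1 subrr.
move: (_ + _) (P *m _) => X Y.
rewrite mul_swap_mx /dlsubmx col_mxKd block_mxEv col_mxKu col_mxKd.
rewrite -(vsubmxK Y) -block_mxEh block_mxEv col_mxKd.
by rewrite -block_mxEv block_mxEh row_mxKl col_mx0.
Qed.

Definition vertex_mx (R : realType) n m (v : 'I_m -> 'rV[R]_n) : 'M[R]_(m, 1 + n) :=
  \matrix_k row_mx 1%:M (v k).

Lemma mul_vertex_mx (R : realType) n m (v : 'I_m -> 'rV[R]_n) (a : 'rV[R]_m) :
  a *m vertex_mx v = row_mx (\sum_k a 0 k)%:M (\sum_k a 0 k *: v k).
Proof.
rewrite mulmx_sum_row -[LHS]hsubmxK !raddf_sum; congr row_mx; apply: eq_bigr => k _.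
  by rewrite /= rowK scale_row_mx row_mxKl scalemx1.
by rewrite /= rowK scale_row_mx row_mxKr.
Qed.

Lemma vertex_mx_unit (R : realType) n (v : 'I_(1 + n) -> 'rV[R]_n) :
  affinely_independent v -> vertex_mx v \in unitmx.
Proof.
move=> hv; rewrite -row_free_unit -kermx_eq0; apply/eqP/row_matrixP => i.
set a := row i _; rewrite row0.
have : a *m vertex_mx v = row_mx 0 0 by rewrite row_mx0 /a -row_mul mulmx_ker row0.
rewrite mul_vertex_mx => /eq_row_mx[s0 v0].
apply/rowP => k; rewrite [RHS]mxE; apply: (hv (a 0)) => //.
by move/matrixP/(_ 0 0): s0; rewrite !mxE eqxx.
Qed.

Lemma conv_hull_polyhedron (R : realType) n (v : 'I_(1 + n) -> 'rV[R]_n) :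
  vertex_mx v \in unitmx ->
  conv_hull v = polyhedron (usubmx (invmx (vertex_mx v))) (dsubmx (invmx (vertex_mx v))).
Proof.
move=> uN; apply/seteqP.
have E (x : 'rV[R]_n) : usubmx (invmx (vertex_mx v)) + x *m dsubmx (invmx (vertex_mx v)) =
    row_mx 1%:M x *m invmx (vertex_mx v).
  by rewrite -[invmx _ in RHS]vsubmxK mul_row_col mul1mx.
split => x; rewrite /conv_hull /polyhedron /= E.
  move=> [a [a0 a1 ->]] k; pose r := \row_k a k.
  suff -> : row_mx 1%:M (\sum_k a k *: v k) = r *m vertex_mx v.
    by rewrite mulmxK// mxE.
  rewrite mul_vertex_mx -a1; congr (row_mx _%:M _);
  by apply: eq_bigr => i _; rewrite mxE.
move=> h; set a := _ *m _ in h; have : a *m vertex_mx v = row_mx 1%:M x.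
  by rewrite mulmxKV.
rewrite mul_vertex_mx => /eq_row_mx[s0 v0]; exists (a 0); split => //.
by move/matrixP/(_ 0 0): s0; rewrite !mxE eqxx.
Qed.

Lemma vol_conv_hull (R : realType) n (v : 'I_(1 + n) -> 'rV[R]_n) :
  vertex_mx v \in unitmx ->
  lebesgue_vol (conv_hull v) = (`|\det (vertex_mx v)| / n`!%:R)%:E.
Proof.
move=> uN; rewrite conv_hull_polyhedron//.
pose E : 'M[R]_(1 + n) := block_mx 1%:M 0 (const_mx (-1)) 1%:M.
have detE : \det E = 1 by rewrite det_lblock !det1 mulr1.
pose w := usubmx (rsubmx (E *m vertex_mx v)).
pose M := dsubmx (rsubmx (E *m vertex_mx v)).
have EN : E *m vertex_mx v = block_mx 1%:M w 0 M.
  rewrite -[LHS]hsubmxK block_mxEh; congr row_mx; last by rewrite vsubmxK.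
    have l1 : lsubmx (vertex_mx v) = col_mx 1%:M (const_mx 1).
      have -> : 1%:M = const_mx 1 :> 'M[R]_1.
        by rewrite [LHS]mx11_scalar; apply/matrixP => i j; rewrite !ord1 !mxE eqxx.
      rewrite col_mx_const; apply/matrixP => i j.
      have : lsubmx (row i (vertex_mx v)) = 1%:M by rewrite rowK row_mxKl.
      move/matrixP/(_ 0 j); rewrite [in RHS]mxE !ord1 eqxx => e.
      by rewrite [RHS]mxE -[RHS]/(true%:R) -e !mxE.
    rewrite -[vertex_mx v]hsubmxK mul_mx_row row_mxKl l1 mul_block_col.
    rewrite !mulmx1 mul1mx mul0mx addr0; congr col_mx.
    by apply/matrixP => i j; rewrite !mxE addNr.
have detM : \det M = \det (vertex_mx v).
  by move/(congr1 determinant): EN; rewrite det_mulmx detE mul1r det_ublock det1 mul1r.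
have uM : M \in unitmx by rewrite unitmxE detM -unitmxE.
have := vol_scaled_unit uM (usubmx (invmx (vertex_mx v)))
  (dsubmx (invmx (vertex_mx v))) w.
have -> : polyhedron (usubmx (invmx (vertex_mx v)) + w *m dsubmx (invmx (vertex_mx v)))
    (M *m dsubmx (invmx (vertex_mx v))) = std_simplex 1.
  have h y : usubmx (invmx (vertex_mx v)) + w *m dsubmx (invmx (vertex_mx v)) +
      y *m (M *m dsubmx (invmx (vertex_mx v))) =
      row_mx (1 - \sum_k y 0 k)%:M y.
    transitivity (row_mx 1%:M y *m (E *m vertex_mx v) *m invmx (vertex_mx v)).
      rewrite EN mul_row_block !mul1mx mulmx0 addr0.
      rewrite -[invmx _ in RHS]vsubmxK mul_row_col mul1mx mulmxDl mulmxA addrA.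
      by [].
    rewrite mulmxA mulmxK// mul_row_block !mul1mx mulmx1 add0r.
    congr row_mx; apply/matrixP => i j; rewrite !ord1 !mxE eqxx mulr1n.
    congr (_ + _); rewrite -sumrN; apply: eq_bigr => k _.
    by rewrite mxE mulrN1.
  apply/seteqP; split => y; rewrite /polyhedron /std_simplex /= h.
    move=> hy; split => [k|]; first by have := hy (rshift 1 k); rewrite row_mxEr.
    by have := hy (lshift n 0); rewrite row_mxEl mxE eqxx mulr1n subr_ge0.
  move=> [h1 h2] k; case: (split_ordP k) => i ->; rewrite ?row_mxEl ?row_mxEr//.
  by rewrite ord1 mxE eqxx mulr1n subr_ge0.
rewrite vol_std_simplex ler01 expr1n mul1r detM => e.
have d0 : `|\det (vertex_mx v)| != 0 by rewrite normr_eq0 -unitfE -unitmxE.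
by rewrite EFinM e muleA -EFinM divff ?mul1e.
Qed.

Lemma int_unit_norm (R : realType) n (Z : 'M[int]_n) :
  Z \in unitmx -> `|\det (map_mx intr Z : 'M[R]_n)| = 1.
Proof.
rewrite unitmxE det_map_mx qualifE /= => /orP[]/eqP ->; rewrite ?normr1//.
by rewrite intrN normrN normr1.
Qed.

Lemma lattice_spanP (R : realType) n (B C : 'M[R]_n) :
  lattice_span B `<=` lattice_span C ->
  exists Z : 'M[int]_n, B = map_mx intr Z *m C.
Proof.
move=> BC.
have /choice[z hz] : forall i, exists z : 'rV[int]_n, row i B = map_mx intr z *m C.
  move=> i; apply: BC; exists (delta_mx 0 i).
  by rewrite map_delta_mx -rowE.
exists (\matrix_i z i); apply/row_matrixP => i.
by rewrite hz row_mul -map_row rowK.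
Qed.

Lemma lattice_detE (R : realType) n (L : set 'rV[R]_n) (B : 'M[R]_n) :
  lattice_basis L B -> lattice_det L = `|\det B|.
Proof.
move=> hB; rewrite /lattice_det.
have [] : [set B | lattice_basis L B] (xget 0 [set B | lattice_basis L B]).
  by apply: xgetPex; exists B.
set C := xget _ _ => uC LC; have [uB LB] := hB.
have [Z BZ] : exists Z : 'M[int]_n, B = map_mx intr Z *m C.
  by apply: lattice_spanP; rewrite -LB -LC.
have [Y CY] : exists Z : 'M[int]_n, C = map_mx intr Z *m B.
  by apply: lattice_spanP; rewrite -LB -LC.
have : Z *m Y = 1%:M.
  have h : map_mx intr (Z *m Y) = map_mx intr 1%:M :> 'M[R]_n.
    rewrite map_mxM map_mx1; apply: (can_inj (mulmxK uB)).
    by rewrite -mulmxA -CY -BZ mul1mx.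
  apply/matrixP => i j; apply: (@intr_inj R).
  by have := congr1 (fun M : 'M[R]_n => M i j) h; rewrite [LHS]mxE [RHS]mxE.
move=> /mulmx1_unit[uZ _].
by rewrite BZ det_mulmx normrM int_unit_norm// mul1r.
Qed.

Lemma lattice_det_int (R : realType) n : lattice_det (int_lattice R n) = 1.
Proof.
rewrite (@lattice_detE _ _ _ 1%:M) ?det1 ?normr1//; split; first exact: unitmx1.
by apply/seteqP; split => x [z ->]; exists z; rewrite mulmx1.
Qed.

Lemma int_unitP (x : int) : (x \is a GRing.unit) = (absz x == 1%N).
Proof. by rewrite qualifE /=; case: x => [[|[|n]]|[|n]]. Qed.

Lemma primitive_vector_dvd d (u : 'rV[int]_d) (e : int) :
  primitive_vector u -> (forall k, (e %| u ord0 k)%Z) -> e \is a GRing.unit.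
Proof.
move=> pu eu; rewrite int_unitP -dvdn1 -pu.
by elim/big_ind: _ => [|x y|k _]; [exact: dvdn0|rewrite dvdn_gcd => -> ->|exact: eu].
Qed.

Lemma primitive_row_unimodular n (u : 'rV[int]_(1 + n)) :
  primitive_vector u -> exists2 U : 'M[int]_(1 + n), U \in unitmx & usubmx U = u.
Proof.
move=> pu; have [L uL [U uU [s _ E]]] := int_Smith_normal_form u.
pose x := L 0 0 * s`_0.
have ux : u = x *: usubmx U.
  rewrite E [L]mx11_scalar mul_scalar_mx -scalemxAl /x -scalerA; congr (_ *: _).
  apply/rowP => k; rewrite !mxE big_ord_recl big1 ?addr0.
    rewrite mxE mulr1n; congr (_ * U _ _); exact/val_inj.
  by move=> i _; rewrite mxE mulr0n mul0r.
have xu : x \is a GRing.unit.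
  apply: (primitive_vector_dvd pu) => k.
  by rewrite ux mxE; apply: dvdz_mulr; exact: dvdzz.
exists (block_mx x%:M 0 0 1%:M *m U).
  by rewrite unitmx_mul uU andbT unitmxE det_ublock det1 det_scalar1 mulr1.
by rewrite -[in LHS](vsubmxK U) mul_block_col col_mxKu mul_scalar_mx mul0mx addr0 -ux.
Qed.

Lemma conv_hull_proj (R : realType) n m q (p : {linear 'rV[R]_n -> 'rV[R]_q})
    (w : 'I_m.+1 -> 'rV[R]_n) (beta : 'I_m.+1 -> R) (i : 'I_m.+1) :
  (forall k, 0 <= beta k) -> \sum_k beta k = 1 -> \sum_k beta k *: w k = 0 ->
  beta i < 1 -> p (w i) = 0 ->
  p @` conv_hull w = conv_hull (fun k => p (w (lift i k))).
Proof.
move=> b0 b1 bw bi pwi.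
have bi0 : 0 < 1 - beta i by rewrite subr_gt0.
have sl (A : zmodType) (f : 'I_m.+1 -> A) :
    \sum_k f k = f i + \sum_k f (lift i k) by rewrite (bigD1_ord i).
apply/seteqP; split => x.
  move=> [_ [a [a0 a1 ->]] <-].
  exists (fun k => a (lift i k) + a i / (1 - beta i) * beta (lift i k)); split.
  - by move=> k; rewrite addr_ge0// mulr_ge0// divr_ge0// ltW.
  - rewrite big_split/= -mulr_sumr; move: a1 b1; rewrite !sl => a1 b1.
    have -> : \sum_k beta (lift i k) = 1 - beta i by rewrite -b1; ring.
    by rewrite divfK ?gt_eqF// addrC.
  - rewrite linear_sum/= sl linearZ/= pwi scaler0 add0r.
    have pb : \sum_k beta (lift i k) *: p (w (lift i k)) = 0.
      have := congr1 p bw; rewrite linear0 linear_sum/= sl linearZ/= pwi scaler0 add0r.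
      by move=> h; rewrite -[RHS]h; apply: eq_bigr => k _; rewrite linearZ.
    under [RHS]eq_bigr do rewrite scalerDl -scalerA.
    rewrite big_split/= -scaler_sumr pb scaler0 addr0.
    by apply: eq_bigr => k _; rewrite linearZ.
move=> [a [a0 a1 ->]].
pose a' k := if unlift i k is Some k' then a k' else 0.
exists (\sum_k a' k *: w k).
  exists a'; split => //.
    by move=> k; rewrite /a'; case: unliftP.
  rewrite sl /a' unlift_none add0r -a1.
  by apply: eq_bigr => k _; rewrite liftK.
rewrite linear_sum/= sl /a' unlift_none scale0r linear0 add0r.
by apply: eq_bigr => k _; rewrite liftK linearZ.
Qed.

Lemma normalized_vol_conv_hull (R : realType) n (v : 'I_(1 + n) -> 'rV[R]_n)
    (L : set 'rV[R]_n) :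
  vertex_mx v \in unitmx ->
  normalized_vol L (conv_hull v) = `|\det (vertex_mx v)| / lattice_det L.
Proof.
move=> uN; rewrite /normalized_vol vol_conv_hull//=; congr (_ / _).
by rewrite mulrC divfK// pnatr_eq0 -lt0n fact_gt0.
Qed.

Lemma mul_del_col (F : comUnitRingType) n m (X : 'M[F]_(m, 1 + (1 + n))) (B : 'M[F]_n) :
  X *m block_mx 1%:M 0 0 (col_mx 0 B) =
  col' (rshift 1 (lshift n ord0)) X *m block_mx 1%:M 0 0 B :> 'M[F]_(m, 1 + n).
Proof.
have E : col' (rshift 1 (lshift n ord0)) X =
    row_mx (lsubmx X) (rsubmx (rsubmx X)) :> 'M[F]_(m, 1 + n).
  apply/matrixP => i k; rewrite mxE.
  case: (split_ordP k) => j ->; rewrite ?row_mxEl ?row_mxEr !mxE; congr (X i _);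
  by apply/val_inj; rewrite /= /bump //; case: j => [] [].
rewrite [in RHS]E -[X in LHS](hsubmxK X) -[rsubmx X in LHS]hsubmxK.
rewrite [RHS](mul_row_block (lsubmx X)) mul_row_block mul_row_col.
by rewrite !mulmx0 !add0r !mulmx1.
Qed.

Lemma norm_minor_invmx (F : realFieldType) n (W : 'M[F]_n.+1) i j : W \in unitmx ->
  `|\det (row' i (col' j W))| = `|\det W| * `|invmx W j i|.
Proof.
move=> uW; rewrite /invmx uW mxE normrM normfV mulrA mulfV ?mul1r; last first.
  by rewrite normr_eq0 -unitfE -unitmxE.
by rewrite mxE /cofactor normrM normrX normrN1 expr1n mul1r.
Qed.

(* [W] expresses the vertices in the coordinates given by a lattice basis
   whose first vector is the primitive vector of [w i]; the projection deletes
   that coordinate, so the ratio of the volumes is an entry of [invmx W]. *)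
Lemma normalized_vol_proj (R : realType) n
    (p : {linear 'rV[R]_(1 + n) -> 'rV[R]_n})
    (w : 'I_(1 + (1 + n)) -> 'rV[R]_(1 + n))
    (beta : 'rV[R]_(1 + (1 + n))) (i : 'I_(1 + (1 + n)))
    (u : 'rV[int]_(1 + n)) (c : R) :
  vertex_mx w \in unitmx ->
  (forall k, 0 <= beta 0 k) -> beta *m vertex_mx w = row_mx 1%:M 0 ->
  beta 0 i < 1 -> primitive_vector u -> 0 < c -> map_mx intr u = c *: w i ->
  (forall x, p x = 0 <-> exists s : R, x = s *: w i) ->
  normalized_vol (p @` int_lattice R (1 + n)) (p @` conv_hull w) =
  c * (1 - beta 0 i) * normalized_vol (int_lattice R (1 + n)) (conv_hull w).
Proof.
move=> uN b0 bN bi pu c0 uw kerp.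
have pwi : p (w i) = 0 by apply/kerp; exists 1; rewrite scale1r.
have [b1 bw] : \sum_k beta 0 k = 1 /\ \sum_k beta 0 k *: w k = 0.
  move: bN; rewrite mul_vertex_mx => /eq_row_mx[/matrixP/(_ 0 0) h ->]; split => //.
  by move: h; rewrite !mxE eqxx.
rewrite (conv_hull_proj b0 b1 bw bi pwi).
have [U uU Uu] := primitive_row_unimodular pu.
pose UR : 'M[R]_(1 + n) := map_mx intr U.
have dUR : `|\det UR| = 1 by exact: int_unit_norm.
have uUR : UR \in unitmx by rewrite unitmxE unitfE -normr_eq0 dUR oner_neq0.
have UR1 : usubmx UR = c *: w i by rewrite -uw -Uu map_usubmx.
pose B : 'M[R]_n := dsubmx (UR *m lin1_mx p).
have URp : UR *m lin1_mx p = col_mx 0 B.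
  rewrite -[LHS]vsubmxK; congr col_mx.
  rewrite -[UR]vsubmxK mul_col_mx col_mxKu UR1 mul_rV_lin1 linearZ/= pwi.
  exact: scaler0.
have uB : B \in unitmx.
  rewrite -row_free_unit -kermx_eq0; apply/eqP/row_matrixP => k.
  have : row k (kermx B) *m B = 0 by rewrite -row_mul mulmx_ker row0.
  move: (row k _) => a aB; rewrite row0.
  have /kerp[s hs] : p (row_mx 0 a *m UR) = 0.
    by rewrite -mul_rV_lin1 -mulmxA URp mul_row_col aB mul0mx addr0.
  have : row_mx (- (s / c)%:M) a *m UR = row_mx 0 0 *m UR.
    rewrite row_mx0 mul0mx.
    transitivity (row_mx (- (s / c)%:M) 0 *m UR + row_mx 0 a *m UR).
      by rewrite -mulmxDl add_row_mx addr0 add0r.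
    rewrite hs -[UR in LHS]vsubmxK mul_row_col mul0mx addr0 UR1 mulNmx.
    by rewrite mul_scalar_mx scalerA divfK ?gt_eqF// addNr.
  by move/(can_inj (mulmxK uUR))/eq_row_mx => [].
have LB : lattice_basis (p @` int_lattice R (1 + n)) B.
  split => //; apply/seteqP; split => x.
    move=> [_ [z ->] <-]; exists (rsubmx (z *m invmx U)).
    rewrite -mul_rV_lin1 -[in LHS](mulmxKV uU z) map_mxM -mulmxA URp.
    by rewrite -[z *m _ in LHS]hsubmxK map_row_mx mul_row_col mulmx0 add0r.
  move=> [z ->]; exists (map_mx intr (row_mx 0 z *m U)).
    by exists (row_mx 0 z *m U).
  rewrite -mul_rV_lin1 map_mxM -mulmxA URp map_row_mx mul_row_col.
  by rewrite mulmx0 add0r.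
pose W := vertex_mx w *m block_mx 1%:M 0 0 (invmx UR).
have uW : W \in unitmx.
  rewrite unitmx_mul uN/= unitmxE det_ublock det1 mul1r -unitmxE.
  by rewrite unitmx_inv.
have dW : `|\det W| = `|\det (vertex_mx w)|.
  by rewrite det_mulmx det_ublock det1 mul1r det_inv normrM normfV dUR invr1 mulr1.
pose j := rshift 1 (lshift n (ord0 : 'I_1)).
have Wji : invmx W j i = c * (1 - beta 0 i).
  have bW : beta *m W = row_mx 1%:M 0.
    by rewrite mulmxA bN mul_row_block !mul1mx !mul0mx !addr0.
  have jE : delta_mx 0 j = row_mx 0 (row_mx 1%:M 0) :> 'rV[R]_(1 + (1 + n)).
    by rewrite /j delta_mx_rshift delta_mx_lshift; congr (row_mx _ (row_mx _ _));
       apply/matrixP => a b; rewrite !ord1 !mxE.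
  have iW : delta_mx 0 i *m W = (beta + c^-1 *: (delta_mx 0 j *m invmx W)) *m W.
    rewrite mulmxDl bW -scalemxAl mulmxKV// jE -rowE row_mul rowK mul_row_block.
    rewrite !mul1mx mulmx0 addr0 add0r.
    have -> : w i = c^-1 *: usubmx UR by rewrite UR1 scalerA mulVf ?gt_eqF// scale1r.
    rewrite -scalemxAl mul_usub_mx mulmxV// scalar_mx_block block_mxEv col_mxKu.
    by rewrite [in RHS]scale_row_mx add_row_mx scaler0 addr0 add0r.
  have := can_inj (mulmxK uW) iW => /matrixP/(_ 0 i).
  have h : (c^-1 *: row j (invmx W)) 0 i = c^-1 * invmx W j i.
    by rewrite mxE; congr (_ * _); rewrite mxE.
  rewrite [LHS]mxE !eqxx -rowE [RHS]mxE h => e.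
  suff -> : 1 - beta 0 i = c^-1 * invmx W j i by rewrite mulrA mulfV ?gt_eqF// mul1r.
  by rewrite -[1]/((true && true)%:R : R) e [LHS]addrC addKr.
pose v' k := p (w (lift i k)).
have vE : vertex_mx v' = row' i (col' j W) *m block_mx 1%:M 0 0 B.
  have -> : row' i (col' j W) = col' j (row' i W).
    by apply/matrixP => a b; rewrite !mxE.
  rewrite -mul_del_col -URp.
  have -> : row' i W = row' i (vertex_mx w) *m block_mx 1%:M 0 0 (invmx UR).
    by apply/matrixP => a b; rewrite !mxE; apply: eq_bigr => k _; rewrite !mxE.
  rewrite -mulmxA mulmx_block !mulmx0 !mul0mx mulmx1 !addr0 add0r mulKmx//.
  apply/row_matrixP => k; rewrite row_mul rowK.
  have -> : row k (row' i (vertex_mx w)) = row (lift i k) (vertex_mx w).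
    by apply/rowP => a; rewrite !mxE.
  by rewrite rowK mul_row_block mul1mx !mulmx0 addr0 add0r mul_rV_lin1.
have dv' : `|\det (vertex_mx v')| =
    c * (1 - beta 0 i) * `|\det (vertex_mx w)| * `|\det B|.
  rewrite vE det_mulmx det_ublock det1 mul1r normrM norm_minor_invmx// dW Wji.
  by rewrite [`|c * _|]ger0_norm ?mulr_ge0 ?subr_ge0 ?ltW// [X in X * _]mulrC.
have B0 : `|\det B| != 0 by rewrite normr_eq0 -unitfE -unitmxE.
have N0 : `|\det (vertex_mx w)| != 0 by rewrite normr_eq0 -unitfE -unitmxE.
have uv' : vertex_mx v' \in unitmx.
  rewrite unitmxE unitfE -normr_eq0 dv' !mulf_neq0// ?gt_eqF ?subr_gt0//.
rewrite (normalized_vol_conv_hull _ uN) (normalized_vol_conv_hull _ uv').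
by rewrite (lattice_detE LB) lattice_det_int divr1 dv' mulfK.
Qed.

Lemma int_vector_primitive d (z : 'rV[int]_d) : z != 0 ->
  exists g : nat, (0 < g)%N /\
    exists2 u : 'rV[int]_d, primitive_vector u & z = g%:Z *: u.
Proof.
move=> z0; pose g := \big[gcdn/0%N]_(k < d) absz (z 0 k).
have gz k : (g %| absz (z ord0 k))%N by apply: (biggcdn_inf k).
have g0 : (0 < g)%N.
  rewrite lt0n; apply: contra z0 => /eqP e; apply/eqP/rowP => k.
  by have := gz k; rewrite e dvd0n absz_eq0 mxE => /eqP.
pose u : 'rV[int]_d := \row_k (z ord0 k %/ g%:Z)%Z.
have zu k : z 0 k = g%:Z * u 0 k by rewrite mxE mulrC divzK// dvdzE; exact: gz.
exists g; split => //; exists u; last by apply/rowP => k; rewrite zu !mxE.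
apply/eqP; rewrite -dvdn1 -(dvdn_pmul2l g0) muln1 {2}/g.
apply/dvdn_biggcdP => k _; rewrite zu abszM dvdn_mul//.
exact: (biggcdn_inf k).
Qed.

Lemma rational_vector_int (R : realType) d (q : 'rV[rat]_d) : q != 0 ->
  exists D : int, 0 < D /\
  exists2 z : 'rV[int]_d, z != 0 & map_mx intr z = D%:~R *: map_mx ratr q :> 'rV[R]_d.
Proof.
move=> q0; pose D := \prod_(k < d) denq (q 0 k).
have D0 : 0 < D by apply: prodr_gt0 => k _; exact: denq_gt0.
pose z := \row_k (numq (q 0 k) * \prod_(l < d | l != k) denq (q 0 l)).
have zE : map_mx intr z = D%:~R *: map_mx ratr q :> 'rV[R]_d.
  apply/rowP => k; rewrite /z !mxE.
  have -> : D = denq (q 0 k) * \prod_(l < d | l != k) denq (q 0 l).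
    by rewrite /D (bigD1 k).
  by rewrite /ratr !intrM; field; rewrite intr_eq0 denq_neq0.
exists D; split => //; exists z => //.
apply: contra q0 => /eqP z0; apply/eqP/rowP => k.
move/matrixP/(_ 0 k): zE; rewrite z0 !mxE => /eqP.
rewrite eq_sym mulf_eq0 intr_eq0 gt_eqF//= fmorph_eq0 => /eqP.
by [].
Qed.

Lemma primitive_dirP (R : realType) d (v : 'rV[R]_d) : rational_direction v ->
  primitive_vector (primitive_dir v) /\
  exists2 c : R, 0 < c & map_mx intr (primitive_dir v) = c *: v.
Proof.
move=> [q [q0 [c0 qv]]]; apply: (@xgetPex _ 0 [set u | primitive_vector u /\
  exists2 c : R, 0 < c & map_mx intr u = c *: v]).
have [D [D0 [z z0 zE]]] := rational_vector_int R q0.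
have [g [g0 [u pu zu]]] := int_vector_primitive z0.
have gR : g%:R != 0 :> R by rewrite pnatr_eq0 -lt0n.
have DR : 0 < D%:~R :> R by rewrite ltr0z.
have uE : map_mx intr u = (g%:R^-1 * (D%:~R * c0)) *: v.
  rewrite -!scalerA -qv -zE zu map_mxZ/= scalerA mulVf ?scale1r//.
have c00 : c0 != 0.
  apply: contra q0 => /eqP c00; move: qv; rewrite c00 scale0r => /matrixP h.
  apply/eqP/rowP => k; move: (h 0 k); rewrite !mxE => /eqP.
  by rewrite fmorph_eq0 => /eqP.
have : c0 < 0 \/ 0 < c0 by apply/orP; rewrite -neq_lt.
case=> c0s.
  exists (- u); split.
    by rewrite /primitive_vector; under eq_bigr do rewrite mxE abszN.
  exists (g%:R^-1 * (D%:~R * - c0)).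
    by rewrite !mulr_gt0 ?oppr_gt0// invr_gt0 ltr0n.
  by rewrite map_mxN uE !mulrN scaleNr.
exists u; split => //; exists (g%:R^-1 * (D%:~R * c0)) => //.
by rewrite !mulr_gt0// invr_gt0 ltr0n.
Qed.

Lemma interior_barycentric_gt0 (R : realType) n (v : 'I_(1 + n) -> 'rV[R]_n)
    (beta : 'rV[R]_(1 + n)) :
  vertex_mx v \in unitmx -> beta *m vertex_mx v = row_mx 1%:M 0 ->
  interior (conv_hull v) 0 -> forall k, 0 < beta 0 k.
Proof.
move=> uN bN iv k.
have [t [t0 ct]] : exists t : R, t < 0 /\ conv_hull v (t *: v k).
  have : nbhs ((0 : R) *: v k) (conv_hull v) by rewrite scale0r.
  move=> /(@scalel_continuous R _ (v k) 0)/nbhs_ballP[e /= e0 he].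
  exists (- (e / 2)); split; first by rewrite oppr_lt0 divr_gt0.
  apply: he; rewrite /ball/= sub0r opprK ger0_norm; lra.
move: ct; rewrite (conv_hull_polyhedron uN) /polyhedron /= => /(_ k).
have -> : usubmx (invmx (vertex_mx v)) + t *: v k *m dsubmx (invmx (vertex_mx v)) =
    (1 - t) *: beta + t *: delta_mx 0 k.
  apply: (can_inj (mulmxK uN)); rewrite [in RHS]mulmxDl -![in RHS]scalemxAl bN -rowE rowK.
  transitivity (row_mx 1%:M (t *: v k) *m invmx (vertex_mx v) *m vertex_mx v).
    by rewrite -[invmx _ in RHS]vsubmxK mul_row_col mul1mx.
  rewrite mulmxKV// !scale_row_mx add_row_mx scaler0 add0r -scalerDl subrK.
  by rewrite scale1r.
rewrite !mxE !eqxx mulr1 => h.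
have t1 : 0 < 1 - t by lra.
by rewrite -(pmulr_rgt0 _ t1); lra.
Qed.

Definition shrunk_vertices (R : realType) (d m : nat) (v : 'I_m -> 'rV[R]_d)
    (j : 'I_m) (t : R) (k : 'I_m) : 'rV[R]_d := if k == j then t *: v k else v k.

(* Barycentric coordinates of the origin with respect to the shrunk vertices,
   from those with respect to the original ones. *)
Definition shrunk_bary (R : realType) (m : nat) (b : 'I_m -> R) (j : 'I_m) (t : R)
    (k : 'I_m) : R := (if k == j then b k else t * b k) / (b j + t * (1 - b j)).

Section Shrink.
Context (R : realType) (d m : nat) (v : 'I_m -> 'rV[R]_d) (b : 'I_m -> R).
Hypotheses (b_gt0 : forall k, 0 < b k) (b_sum1 : \sum_k b k = 1)
  (b_vertices : \sum_k b k *: v k = 0).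

Lemma bary_le_subr i j : i != j -> b i <= 1 - b j.
Proof.
move=> ij; rewrite -b_sum1 (bigD1 j)//= addrAC subrr add0r (bigD1 i)//= lerDl.
by apply: sumr_ge0 => k _; exact: ltW.
Qed.

Lemma bary_le1 j : b j <= 1.
Proof.
rewrite -b_sum1 (bigD1 j)//= lerDl.
by apply: sumr_ge0 => k _; exact: ltW.
Qed.

Lemma shrunk_denom_gt0 j t : 0 <= t -> 0 < b j + t * (1 - b j).
Proof. by move=> t0; rewrite ltr_wpDr// mulr_ge0// subr_ge0 bary_le1. Qed.

Lemma shrunk_bary_ge0 j t k : 0 <= t -> 0 <= shrunk_bary b j t k.
Proof.
move=> t0; rewrite /shrunk_bary divr_ge0//; last exact/ltW/shrunk_denom_gt0.
by case: ifP => _; [exact/ltW|rewrite mulr_ge0//; exact/ltW].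
Qed.

Lemma shrunk_bary_sum1 j t : 0 <= t -> \sum_k shrunk_bary b j t k = 1.
Proof.
move=> t0; have D0 := shrunk_denom_gt0 j t0.
rewrite /shrunk_bary -mulr_suml (bigD1 j)//= eqxx.
rewrite (eq_bigr (fun k => t * b k)) => [|k /negbTE -> //].
rewrite -mulr_sumr.
have -> : \sum_(k | k != j) b k = 1 - b j.
  by rewrite -b_sum1 [X in X - _](bigD1 j)//= addrAC subrr add0r.
by rewrite divff// gt_eqF.
Qed.

Lemma shrunk_bary_vertices j t :
  \sum_k shrunk_bary b j t k *: shrunk_vertices v j t k = 0.
Proof.
transitivity ((t / (b j + t * (1 - b j))) *: \sum_k b k *: v k).
  rewrite scaler_sumr; apply: eq_bigr => k _.
  rewrite /shrunk_bary /shrunk_vertices scalerA.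
  by case: ifP => _; rewrite ?scalerA; congr (_ *: _); ring.
by rewrite b_vertices scaler0.
Qed.

Lemma shrunk_affinely_independent j t : 0 <= t -> affinely_independent v ->
  affinely_independent (shrunk_vertices v j t).
Proof.
move=> t0 hv a a0 av.
have D0 := shrunk_denom_gt0 j t0.
pose s k := (if k == j then t * a k else a k) - (t - 1) * a j * b k.
have s0 : \sum_k s k = 0.
  rewrite /s sumrB -mulr_sumr b_sum1 mulr1 (bigD1 j)//= eqxx.
  rewrite (eq_bigr a) => [|k /negbTE -> //].
  have -> : \sum_(k | k != j) a k = - a j.
    by apply/eqP; rewrite -addr_eq0 addrC; move: a0; rewrite (bigD1 j)//= => ->.
  ring.
have sv : \sum_k s k *: v k = 0.
  under eq_bigr do rewrite scalerBl -scalerA.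
  rewrite sumrB -scaler_sumr b_vertices scaler0 subr0 -[RHS]av.
  apply: eq_bigr => k _; rewrite /shrunk_vertices; case: ifP => _ //.
  by rewrite scalerA mulrC.
have sk := hv s s0 sv.
have aj : a j = 0.
  have := sk j; rewrite /s eqxx => e; apply/eqP.
  have : a j * (b j + t * (1 - b j)) = 0 by rewrite -[RHS]e; ring.
  by move/eqP; rewrite mulf_eq0 (gt_eqF D0) orbF.
move=> k; have [->//|kj] := eqVneq k j.
by have := sk k; rewrite /s (negbTE kj) aj mulr0 mul0r subr0.
Qed.

Lemma shrunk_bary_lt1 i j t : 0 <= t -> (i == j -> 0 < t) -> (1 < m)%N ->
  shrunk_bary b j t i < 1.
Proof.
move=> t0 ijt m1; have D0 := shrunk_denom_gt0 j t0.
rewrite /shrunk_bary ltr_pdivrMr// mul1r; case: eqVneq ijt => [->|ij] ijt.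
  rewrite ltrDl mulr_gt0 ?ijt//.
  have [k kj] : exists k, k != j.
    have : (0 < #|[pred k | k != j]|)%N.
      by have := cardC1 j; rewrite card_ord => ->; rewrite -subn1 subn_gt0.
    by move=> /card_gt0P[k]; rewrite inE => ?; exists k.
  exact: lt_le_trans (b_gt0 k) (bary_le_subr kj).
by have := ler_wpM2l t0 (bary_le_subr ij); have := b_gt0 j; lra.
Qed.

End Shrink.

Lemma normalized_vol_proj_shrink (R : realType) n
    (p : {linear 'rV[R]_(1 + n) -> 'rV[R]_n})
    (v : 'I_(1 + (1 + n)) -> 'rV[R]_(1 + n)) (b : 'I_(1 + (1 + n)) -> R)
    (i j : 'I_(1 + (1 + n))) (u : 'rV[int]_(1 + n)) (c t : R) :
  affinely_independent v -> (forall k, 0 < b k) -> \sum_k b k = 1 ->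
  \sum_k b k *: v k = 0 -> primitive_vector u -> 0 < c ->
  map_mx intr u = c *: v i ->
  (forall x, p x = 0 <-> exists s : R, x = s *: v i) ->
  0 <= t -> (i == j -> 0 < t) ->
  normalized_vol (p @` int_lattice R (1 + n)) (p @` shrink_vertex v j t) =
  (if i == j then c / t else c) * (1 - shrunk_bary b j t i) *
    normalized_vol (int_lattice R (1 + n)) (shrink_vertex v j t).
Proof.
move=> hv b0 b1 bv pu c0 uv kerp t0 ijt.
pose beta := \row_k shrunk_bary b j t k.
have bi : beta 0 i = shrunk_bary b j t i by rewrite mxE.
rewrite -bi; apply: (@normalized_vol_proj _ _ _ (shrunk_vertices v j t) beta i u) => //.
- exact/vertex_mx_unit/shrunk_affinely_independent.
- by move=> k; rewrite mxE; apply: shrunk_bary_ge0.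
- rewrite mul_vertex_mx.
  have -> : \sum_k beta 0 k = 1.
    by rewrite -(shrunk_bary_sum1 b0 b1 j t0); apply: eq_bigr => k _; rewrite mxE.
  congr row_mx; rewrite -[RHS](shrunk_bary_vertices bv j t).
  by apply: eq_bigr => k _; rewrite mxE.
- by rewrite bi shrunk_bary_lt1.
- by case: ifP => // ij; rewrite divr_gt0// ijt.
- rewrite uv /shrunk_vertices; case: ifP => // ij.
  by rewrite scalerA divfK// gt_eqF// ijt.
- move=> x; rewrite kerp /shrunk_vertices; case: ifP => // ij.
  split=> -[s ->]; last by exists (s * t); rewrite scalerA.
  by exists (s / t); rewrite scalerA divfK// gt_eqF// ijt.
Qed.

Lemma normalized_vol_shrink_neq0 (R : realType) n
    (v : 'I_(1 + n) -> 'rV[R]_n) (b : 'I_(1 + n) -> R) j t :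
  affinely_independent v -> (forall k, 0 < b k) -> \sum_k b k = 1 ->
  \sum_k b k *: v k = 0 -> 0 <= t ->
  normalized_vol (int_lattice R n) (shrink_vertex v j t) != 0.
Proof.
move=> hv b0 b1 bv t0.
have uN : vertex_mx (shrunk_vertices v j t) \in unitmx.
  exact/vertex_mx_unit/(shrunk_affinely_independent b0 b1 bv).
rewrite (normalized_vol_conv_hull _ uN) lattice_det_int divr1.
by rewrite normr_eq0 -unitfE -unitmxE.
Qed.

Theorem theorem4p14 (R : realType) (d : nat) (hd : (0 < d)%N)
    (v : 'I_d.+1 -> 'rV[R]_d)
    (simplex_v : affinely_independent v)
    (origin_v : interior (conv_hull v) 0)
    (rational_v : forall i, rational_direction (v i))
    (proj : 'I_d.+1 -> {linear 'rV[R]_d -> 'rV[R]_d.-1})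
    (ker_proj : forall i x, proj i x = 0 <-> exists c : R, x = c *: v i) :
  let Zd := int_lattice R d in
  let St := shrink_vertex v in
  let Volproj (i : 'I_d.+1) (K : set 'rV[R]_d) :=
    normalized_vol (proj i @` Zd) (proj i @` K) in
  exists j : 'I_d.+1,
    let lhs (t : R) := 2^-1 *
      ((\sum_(i < d.+1) Volproj i (St j t)) / normalized_vol Zd (St j t)) in
    let rhs :=
      (\sum_(i < d.+1 | i != j) Volproj i (St j 0)) /
      normalized_vol Zd (St j 0) in
    [/\ cvg (lhs t @[t --> 0^'+]),
        lim (lhs t @[t --> 0^'+]) >= rhs
      & lim (lhs t @[t --> 0^'+]) = rhs <->
        \sum_(i < d.+1) primitive_dir (v i) = 0].
Proof.
case: d hd v simplex_v origin_v rational_v proj ker_proj =>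
  [//|n] _ v simplex_v origin_v rational_v proj ker_proj Zd St Volproj.
have uN : vertex_mx (v : 'I_(1 + (1 + n)) -> 'rV[R]_(1 + n)) \in unitmx.
  exact: vertex_mx_unit.
pose beta := row_mx 1%:M 0 *m invmx (vertex_mx (v : 'I_(1 + (1 + n)) -> 'rV[R]_(1 + n))).
have bN : beta *m vertex_mx (v : 'I_(1 + (1 + n)) -> 'rV[R]_(1 + n)) = row_mx 1%:M 0.
  exact: mulmxKV.
pose b (k : 'I_n.+2) : R := beta 0 k.
have b0 : forall k, 0 < b k by exact: (interior_barycentric_gt0 uN bN origin_v).
have [b1 bv] : \sum_k b k = 1 /\ \sum_k b k *: v k = 0.
  move: bN; rewrite mul_vertex_mx => /eq_row_mx[/matrixP/(_ 0 0) h e]; split => //.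
  by move: h; rewrite !mxE eqxx.
have /choice[c hc] : forall i, exists c : R,
    0 < c /\ map_mx intr (primitive_dir (v i)) = c *: v i.
  by move=> i; have [_ [c c0 e]] := primitive_dirP (rational_v i); exists c.
have pu i : primitive_vector (primitive_dir (v i)).
  by have [] := primitive_dirP (rational_v i).
have c0 i : 0 < c i by have [] := hc i.
have uv i : map_mx intr (primitive_dir (v i)) = c i *: v i by have [] := hc i.
have [j hj] : exists j, forall i, b j * c i <= b i * c j.
  case: (@arg_minP _ _ _ ord0 xpredT (fun i => b i / c i) isT) => j _ hj.
  exists j => i; have := hj i isT.
  by rewrite ler_pdivrMr// mulrAC ler_pdivlMr.
exists j => lhs rhs.
have ratio i t : 0 <= t -> (i == j -> 0 < t) -> Volproj i (St j t) =
    (if i == j then c i / t else c i) * (1 - shrunk_bary b j t i) *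
    normalized_vol Zd (St j t).
  move=> t0 ijt.
  exact: (@normalized_vol_proj_shrink R n (proj i) v b i j _ (c i) t simplex_v b0 b1 bv
    (pu i) (c0 i) (uv i) (ker_proj i) t0 ijt).
have V0 t : 0 <= t -> normalized_vol Zd (St j t) != 0.
  exact: (@normalized_vol_shrink_neq0 R n.+1 v b j t simplex_v b0 b1 bv).
pose S := \sum_(i | i != j) c i.
have rhsE : rhs = S.
  rewrite /rhs mulr_suml; apply: eq_bigr => i ij.
  rewrite ratio ?lexx// ?(negbTE ij)// mulfK ?V0//.
  by rewrite /shrunk_bary (negbTE ij) mul0r mul0r subr0 mulr1.
pose T := \sum_(i | i != j) c i * b i.
pose g t := 2^-1 * (S + (c j * (1 - b j) - T * t) / (b j + t * (1 - b j))).
have lhsE t : 0 < t -> lhs t = g t.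
  move=> t0; rewrite /lhs /g; congr (_ * _).
  have D0 := shrunk_denom_gt0 b0 b1 j (ltW t0).
  rewrite mulr_suml (bigD1 j)//= ratio ?ltW// eqxx mulfK ?V0 ?ltW//.
  rewrite (eq_bigr (fun i => c i - c i * b i * (t / (b j + t * (1 - b j))))); last first.
    move=> i ij; rewrite ratio ?ltW// (negbTE ij) mulfK ?V0 ?ltW//.
    by rewrite /shrunk_bary (negbTE ij); ring.
  rewrite sumrB -mulr_suml -/S -/T /shrunk_bary eqxx.
  by field; rewrite !gt_eqF.
pose l := 2^-1 * (S + (c j * (1 - b j)) / b j).
have gl : g t @[t --> 0^'+] --> l.
  apply: cvg_at_right_filter.
  have -> : l = 2^-1 * (S + (c j * (1 - b j) - T * 0) / (b j + 0 * (1 - b j))).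
    by rewrite mulr0 mul0r subr0 addr0.
  apply: cvgM; first exact: cvg_cst.
  apply: cvgD; first exact: cvg_cst.
  apply: cvgM.
    by apply: cvgB; [exact: cvg_cst|apply: cvgM; [exact: cvg_cst|exact: cvg_id]].
  apply: cvgV; first by rewrite mul0r addr0 gt_eqF.
  by apply: cvgD; [exact: cvg_cst|apply: cvgM; [exact: cvg_id|exact: cvg_cst]].
have ll : lhs t @[t --> 0^'+] --> l.
  apply: cvg_trans gl; apply: near_eq_cvg.
  by near=> t; apply/esym/lhsE; near: t; exact: nbhs_right_gt.
have limE : lim (lhs t @[t --> 0^'+]) = l by exact: cvg_lim.
have lS : l - S = 2^-1 * (c j - b j * (c j + S)) / b j.
  by rewrite /l; field; rewrite gt_eqF.
have sumE : c j - b j * (c j + S) = \sum_i (b i * c j - b j * c i).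
  rewrite sumrB -mulr_suml -mulr_sumr b1 mul1r; congr (_ - _ * _).
  by rewrite [RHS](bigD1 j).
have pos i : 0 <= b i * c j - b j * c i by rewrite subr_ge0.
split.
- by apply/cvg_ex; exists l.
- rewrite limE rhsE -subr_ge0 lS sumE !mulr_ge0 ?invr_ge0 ?sumr_ge0//.
  exact/ltW.
rewrite limE rhsE; transitivity (\sum_i c i *: v i = 0).
  split=> [lE|cv].
    have s0 : \sum_i (b i * c j - b j * c i) = 0.
      rewrite -sumE; apply/eqP; move/eqP: lS; rewrite lE subrr eq_sym.
      by rewrite !mulf_eq0 !invr_eq0 (gt_eqF (b0 j)) pnatr_eq0 orbF.
    have e i : c i = c j / b j * b i.
      have /eqP := @psumr_eq0P _ _ xpredT _ (fun i _ => pos i) s0 i isT.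
      rewrite subr_eq0 => /eqP e.
      by rewrite mulrAC [c j * _]mulrC e mulrAC divff ?mul1r// gt_eqF.
    rewrite (eq_bigr (fun i => (c j / b j) *: (b i *: v i))); last first.
      by move=> i _; rewrite scalerA -e.
    by rewrite -scaler_sumr bv scaler0.
  have e1 : \sum_i (c i - (c j + S) * b i) = 0.
    rewrite sumrB -mulr_sumr b1 mulr1; apply/eqP; rewrite subr_eq0.
    by rewrite [X in X == _](bigD1 j).
  have e2 : \sum_i (c i - (c j + S) * b i) *: v i = 0.
    under eq_bigr do rewrite scalerBl -scalerA.
    by rewrite sumrB -scaler_sumr cv bv scaler0 subr0.
  have /eqP := simplex_v _ e1 e2 j.
  rewrite subr_eq0 mulrC => /eqP h; apply/eqP; rewrite -subr_eq0 lS -h subrr.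
  by rewrite mulr0 mul0r.
have map0 : map_mx intr (\sum_i primitive_dir (v i)) = \sum_i c i *: v i.
  rewrite raddf_sum; apply: eq_bigr => i _; exact: uv.
rewrite -map0; split => [h|->]; last exact: map_mx0.
apply/rowP => k; move/matrixP/(_ 0 k): h; rewrite [LHS]mxE [RHS]mxE => /eqP.
by rewrite intr_eq0 => /eqP ->; rewrite mxE.
Unshelve. all: by end_near.
Qed.
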